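(* Let $n\ge5$. The map $\sigma:\mathcal{T}_n/\!\sim\;\to\mathcal{B}_n$ is a bijection.
   Context: $\mathcal{T}_n$ is the set of triangulations of the punctured regular $n$-gon $\mathcal{P}_n$ (a regular $n$-gon with a puncture in its center), i.e. maximal sets of pairwise non-crossing tagged diagonals: untagged arcs between border vertices $a\neq b$ homotopic to the counterclockwise border path from $a$ to $b$ passing through at least $3$ border vertices, and arcs from the puncture to a border vertex with a tag $\pm1$, where two puncture arcs at $a,c$ with tags $\epsilon,\epsilon'$ cross iff $a\ne c$ and $\epsilon\ne\epsilon'$. The relation $\sim$ is generated by rotating the polygon and by inverting all tags. $\mathcal{B}_n$ is the set of equivalence classes of planar rooted trees such that every node other than the root has either two or no children (so each full subtree not containing the root is a full binary tree), the tree has exactly $n$ leaves, and two trees are equivalent if one is obtained from the other by (cyclically) rotating the subtrees at the root. The map $\sigma$: given $\Delta$, when two diagonals join the puncture to the same border vertex draw one of them as a loop at that vertex enclosing the puncture (the other lying inside, forming a self-folded triangle). Take one node for each triangle of $\Delta$; join two triangles by an edge if they are adjacent and their common side is not an arc from the puncture to the border (a loop does not count as such an arc); for each border edge of a triangle draw an edge from that triangle's node crossing the border edge to a new leaf outside the polygon; finally identify all nodes of triangles having the puncture as a vertex into a single root. With the planar embedding inherited from the polygon, this gives a tree whose class in $\mathcal{B}_n$ is $\sigma(\Delta)$; it depends only on the $\sim$-class of $\Delta$. *)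

(* Defs.v *)
(* Combinatorial encoding of tagged triangulations of the
   punctured n-gon and of the map sigma to planar rooted trees.
   Border vertices are 'I_n, numbered 0..n-1 counterclockwise. *)
From mathcomp Require Import all_boot.
From Stdlib Require Import Relations.

Set Implicit Arguments.
Unset Strict Implicit.
Unset Printing Implicit Defensive.

Section Arcs.
Variable n : nat.

(* Candidate tagged arcs:
   inl (a, b)   : the untagged arc from border vertex a to border vertex b,
                  homotopic to the counterclockwise border path a, a+1, ..., b;
   inr (c, eps) : the arc from the puncture to border vertex c with tag
                  eps (true = +1, false = -1). *)
Definition tarc := (('I_n * 'I_n) + ('I_n * bool))%type.

(* number of border edges on the counterclockwise path from a to b *)
Definition gap (a b : 'I_n) : nat := (b + n - a) %% n.

(* the ccw border path from a to b passes through at least 3 vertices *)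
Definition valid_arc (x : tarc) : bool :=
  match x with
  | inl (a, b) => (a != b) && (2 <= gap a b)
  | inr _ => true
  end.

(* border edge e is the edge from e to e+1; edges on the ccw path a -> b *)
Definition path_edges (a b : 'I_n) : {set 'I_n} :=
  [set e : 'I_n | gap a e < gap a b].

Definition interior (a b v : 'I_n) : bool := (0 < gap a v) && (gap a v < gap a b).

Definition compat (x y : tarc) : bool :=
  match x, y with
  | inl (a, b), inl (c, d) =>
      [|| path_edges a b \subset path_edges c d,
          path_edges c d \subset path_edges a b |
          [disjoint path_edges a b & path_edges c d]]
  | inl (a, b), inr (c, _) => ~~ interior a b c
  | inr (c, _), inl (a, b) => ~~ interior a b c
  | inr (a, e), inr (c, e') => (a == c) || (e == e')
  end.

Definition triangulation (D : {set tarc}) : Prop :=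
  [/\ forall x, x \in D -> valid_arc x,
      forall x y, x \in D -> y \in D -> compat x y &
      forall x, valid_arc x -> (forall y, y \in D -> compat x y) -> x \in D].

Definition shiftv (x : 'I_n) : 'I_n :=
  Ordinal (ltn_pmod x.+1 (leq_ltn_trans (leq0n x) (ltn_ord x))).

Definition rot_arc (x : tarc) : tarc :=
  match x with
  | inl (a, b) => inl (shiftv a, shiftv b)
  | inr (c, e) => inr (shiftv c, e)
  end.

Definition inv_arc (x : tarc) : tarc :=
  match x with
  | inl p => inl p
  | inr (c, e) => inr (c, ~~ e)
  end.

Definition tri_step (D D' : {set tarc}) : Prop :=
  D' = rot_arc @: D \/ D' = inv_arc @: D.

Definition tri_equiv : relation {set tarc} := clos_refl_sym_trans _ tri_step.

End Arcs.

Inductive bt : Type := Leaf | Node of bt & bt.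

Fixpoint bt_leaves (t : bt) : nat :=
  match t with Leaf => 1 | Node l r => bt_leaves l + bt_leaves r end.

(* A planar rooted tree whose non-root nodes have 0 or 2 children is the
   sequence of the (full binary) subtrees at the root, in planar order. *)
Definition rtree := seq bt.

Definition rtree_leaves (s : rtree) : nat := sumn (map bt_leaves s).

Definition rot_equiv (s t : rtree) : Prop := exists k, rot k s = t.

Section Sigma.
Variable n : nat.
Variable D : {set tarc n}.

Definition has_arc (x y : nat) : bool :=
  [exists a : 'I_n, exists b : 'I_n,
     [&& val a == x %% n, val b == y %% n & inl (a, b) \in D]].

(* side from x to x+g of a triangle: border edge (g = 1) or an arc of D *)
Definition side_ok (x g : nat) : bool := (g == 1) || has_arc x (x + g).

(* Dual tree of the region cut off (away from the puncture) by the side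
   from x to x+g (ccw; g border edges): the triangle on that side has apex
   x+k; its node has children the trees of the sides (x, x+k) and
   (x+k, x+g) in counterclockwise order; a border edge gives a leaf. *)
Fixpoint cap_tree (fuel x g : nat) : bt :=
  match fuel with
  | 0 => Leaf
  | fuel'.+1 =>
      if g <= 1 then Leaf else
      let k := head 1 [seq k <- iota 1 g.-1 | side_ok x k && side_ok (x + k) (g - k)] in
      Node (cap_tree fuel' x k) (cap_tree fuel' (x + k) (g - k))
  end.

Definition punct_verts : seq nat :=
  [seq val c | c <- enum 'I_n & [exists e : bool, inr (c, e) \in D]].

(* Triangles with the puncture as a vertex are identified into the root.
   Between consecutive (ccw) vertices c, c' joined to the puncture there is
   one such triangle, whose third side (from c to c') is a border edge (leaf)
   or a border arc (subtree).  If a single vertex a is joined to the puncture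
   (self-folded triangle with loop at a), the root has one child: the tree
   of the region outside the loop, i.e. the side from a to a+n. *)
Definition sigma : rtree :=
  let C := punct_verts in
  let C' := rcons (behead C) (head 0 C + n) in
  [seq cap_tree n p.1 (p.2 - p.1) | p <- zip C C'].

End Sigma.

(* Main.v *)
(** A planar tree with subtrees [t_1, ..., t_k] at the root cuts the cyclic
    sequence of border edges into the arcs spanned by its subtrees.  These arcs,
    together with puncture arcs at the starting points of the [t_i] (with both
    tags when [k = 1]), form a triangulation [tri_of s z e], where [z] is the
    starting vertex and [e] the tag: two arcs are compatible iff their sets of
    border edges are nested or disjoint, and a set of edges that is laminar with
    respect to all subtrees of a binary tree is itself spanned by a subtree.

    Conversely, every triangulation [D] contains [tri_of (sigma D) z e] for some
    [z] and [e]: a cut off region has a triangle on its outer side, since the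
    longest side starting at its first vertex can be completed to a triangle by
    maximality.  As both sets are maximal they are equal, so [D] is determined by
    [sigma D] up to rotation and tag inversion. *)
Require Import Defs.
From HB Require Import structures.
From mathcomp Require Import all_boot zify.
From Stdlib Require Import Relations.

Set Implicit Arguments.
Unset Strict Implicit.
Unset Printing Implicit Defensive.

(** Decidable equality on trees gives boolean membership in the lists [tops] below. *)
Lemma bt_eq_dec : comparable bt.
Proof. by rewrite /comparable /decidable; decide equality. Qed.
HB.instance Definition _ := hasDecEq.Build bt (compareP bt_eq_dec).

Section Punctured.

Variable n : nat.
Hypothesis n_gt1 : 1 < n.

Implicit Types (a b c x : 'I_n) (y z g h k : nat) (D : {set tarc n}).

(** * Vertices and border edges modulo n *)

(** Positions are natural numbers reduced modulo [n] only here, so that sums such as [z + g] can run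
    past the origin. *)
Definition vtx z : 'I_n := Ordinal (ltn_pmod z (ltnW n_gt1)).

Lemma vtxDn z : vtx (z + n) = vtx z.
Proof. by apply: val_inj; rewrite /= modnDr. Qed.

Lemma vtx_val a : vtx a = a.
Proof. by apply: val_inj; rewrite /= modn_small. Qed.

Lemma shiftv_vtx z : shiftv (vtx z) = vtx z.+1.
Proof. by apply: val_inj; rewrite /= -addn1 modnDml addn1. Qed.

Lemma gapE a b : gap a b = if a <= b then b - a else b + n - a.
Proof.
rewrite /gap; have := ltn_ord a; have := ltn_ord b; case: (leqP a b) => ab ltb lta.
  by rewrite -addnBAC // modnDr modn_small //; lia.
by rewrite modn_small //; lia.
Qed.

Lemma ltn_gap a b : gap a b < n.
Proof. by rewrite ltn_mod ltnW. Qed.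

(** Measuring every gap from one base vertex turns cyclic positions into linear ones, and questions
    about cyclic intervals into arithmetic. *)
Lemma gap_rebase x a b :
  gap a b = if gap x a <= gap x b then gap x b - gap x a
            else gap x b + n - gap x a.
Proof.
have := ltn_ord x; have := ltn_ord a; have := ltn_ord b; rewrite !gapE.
by case: (leqP x a); case: (leqP x b); case: (leqP a b) => *; case: ifP; lia.
Qed.

Lemma gap_vtx z g : g < n -> gap (vtx z) (vtx (z + g)) = g.
Proof.
move=> gn; rewrite /gap /= -(modnDml z g); have := ltn_pmod z (ltnW n_gt1).
move: (z %% n) => {}z zn; have -> : (z + g) %% n = if z + g < n then z + g else z + g - n.
  case: ltnP => h; first by rewrite modn_small.
  by rewrite -{1}(subnK h) modnDr modn_small //; lia.
case: ltnP => h.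
  by rewrite (_ : _ - _ = g + n) ?modnDr ?modn_small //; lia.
by rewrite (_ : _ - _ = g) ?modn_small //; lia.
Qed.

Lemma gapxx a : gap a a = 0.
Proof. by rewrite gapE leqnn subnn. Qed.

Lemma vtx_gap z c : vtx (z + gap (vtx z) c) = c.
Proof.
have [a_c ->] : exists a_c : nat, c = vtx a_c by exists c; rewrite vtx_val.
apply: val_inj; rewrite /= /gap /= modnDmr -modnDml.
have zn := ltn_pmod z (ltnW n_gt1).
rewrite (_ : _ + _ = a_c %% n + n) ?modnDr ?modn_mod //; lia.
Qed.

Lemma gap_inj x a b : gap x a = gap x b -> a = b.
Proof. by move=> e; rewrite -(vtx_gap x a) -(vtx_gap x b) vtx_val e. Qed.

Lemma gap_shift z k c : k < n ->
  gap (vtx (z + k)) c = if k <= gap (vtx z) c then gap (vtx z) c - k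
                        else gap (vtx z) c + n - k.
Proof. by move=> kn; rewrite (gap_rebase (vtx z)) gap_vtx. Qed.

(** Unlike [path_edges], this also covers [g = n], the full boundary, which is the outer side of a
    self-folded triangle. *)
Definition edges z g : {set 'I_n} := [set x | gap (vtx z) x < g].

Lemma edges_vtx z g : g < n -> path_edges (vtx z) (vtx (z + g)) = edges z g.
Proof. by move=> gn; rewrite /path_edges gap_vtx. Qed.

Lemma edges1 z : edges z 1 = [set vtx z].
Proof.
apply/setP => c; rewrite !inE ltnS leqn0; apply/eqP/eqP => [e|->]; last exact: gapxx.
by apply: (@gap_inj (vtx z)); rewrite e gapxx.
Qed.

Lemma edges_full z : edges z n = setT.
Proof. by apply/setP => c; rewrite !inE ltn_gap. Qed.

Lemma mem_vtx_edges z g : 0 < g -> vtx z \in edges z g.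
Proof. by rewrite inE gapxx. Qed.

Lemma edges0 z : edges z 0 = set0.
Proof. by apply/setP => c; rewrite !inE. Qed.

Lemma edgesD z k l : k + l <= n ->
  edges z (k + l) = edges z k :|: edges (z + k) l.
Proof.
case: l => [|l] kl; first by rewrite edges0 setU0 addn0.
have kn : k < n by lia.
apply/setP => c; rewrite !inE gap_shift //; have := ltn_gap (vtx z) c.
by move: (gap _ c) => p; case: (leqP k p); lia.
Qed.

Lemma disjoint_edges z k l : k + l <= n ->
  [disjoint edges z k & edges (z + k) l].
Proof.
case: l => [|l] kl; first by rewrite edges0 -setI_eq0 setI0.
have kn : k < n by lia.
apply/pred0P => c /=; rewrite !inE gap_shift //; have := ltn_gap (vtx z) c.
by move: (gap _ c) => p; case: (leqP k p); lia.
Qed.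

Lemma card_edges z g : g <= n -> #|edges z g| = g.
Proof.
elim: g => [|g IHg] gn; first by rewrite edges0 cards0.
rewrite -addn1 in gn *; have := disjoint_edges z gn.
rewrite edgesD // -setI_eq0 cardsU => /eqP ->.
by rewrite cards0 subn0 edges1 cards1 IHg //; lia.
Qed.

(** A proper interval has a unique first edge: if [y] came later than [z] in it, the edge just
    before [y] would lie in [edges z g] but not in [edges y h]. *)
Lemma edges_inj z g y h : 0 < g < n -> 0 < h < n ->
  edges z g = edges y h -> vtx z = vtx y /\ g = h.
Proof.
move=> gn hn /setP e.
have ey c : (gap (vtx z) c < g) = (gap (vtx y) c < h) by have := e c; rewrite !inE.
have zy : vtx z = vtx y.
  apply: (@gap_inj (vtx z)); rewrite gapxx.
  have /esym := ey (vtx y); rewrite gapxx; set p := gap _ _ => pg.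
  have pn : p < n by apply: ltn_gap.
  case: (posnP p) => [-> //|p0]; have := ey (vtx (z + p.-1)).
  rewrite gap_vtx; last lia.
  rewrite (gap_rebase (vtx z)) gap_vtx -/p; last lia.
  by case: ifP; lia.
split=> //; have := ey (vtx (z + g)); have := ey (vtx (z + h)).
by clear e; rewrite -zy !gap_vtx; [lia..].
Qed.

(** Vertices are identified with the border edges starting there, so [vtx v \in edges y h] says that
    [v] is the first or an interior vertex of the interval. An interval starting inside [edges z g]
    could leave it only through [z + g] as an interior vertex. *)
Lemma sub_edges z g y h : g < n -> vtx y \in edges z g ->
  (vtx (z + g) \in edges y h -> vtx (z + g) = vtx y) ->
  edges y h \subset edges z g.
Proof.
move=> gn; rewrite !inE => yz.
rewrite (gap_rebase (vtx z)) gap_vtx // (ltnW yz) => nint.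
have le_yh : gap (vtx z) (vtx y) + h <= g.
  rewrite leqNgt; apply/negP => lt_yh.
  have /(congr1 (gap (vtx z))) : vtx (z + g) = vtx y by apply: nint; lia.
  by rewrite gap_vtx; lia.
apply/subsetP => c; rewrite !inE (gap_rebase (vtx z)).
by have := ltn_gap (vtx z) c; case: ifP; lia.
Qed.

(** * Laminar sets of border edges *)

Definition laminar (X Y : {set 'I_n}) :=
  [|| X \subset Y, Y \subset X | [disjoint X & Y]].

Lemma laminarC X Y : laminar X Y = laminar Y X.
Proof. by rewrite /laminar disjoint_sym orbCA. Qed.

Lemma laminar1 X c : laminar X [set c].
Proof.
rewrite /laminar sub1set; case: (boolP (c \in X)) => cX; rewrite ?orbT //=.
by rewrite disjoint_sym disjoints1 cX orbT.
Qed.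

Lemma laminar_sub (X Y : {set 'I_n}) : X \subset Y -> laminar X Y.
Proof. by rewrite /laminar => ->. Qed.

Lemma laminarT X : laminar X setT.
Proof. exact/laminar_sub/subsetT. Qed.

(** Non-crossing can be tested at the two ends of one interval. If [y] starts inside [edges z g], it
    cannot get out past [z + g]; if it starts outside, it cannot get in past [z]. *)
Lemma laminar_edges z g y h : g < n ->
  (vtx z \in edges y h -> vtx z = vtx y) ->
  (vtx (z + g) \in edges y h -> vtx (z + g) = vtx y) ->
  laminar (edges z g) (edges y h).
Proof.
move=> gn zint zgint; have [yz|yz] := boolP (vtx y \in edges z g).
  by rewrite laminarC; apply/laminar_sub/sub_edges.
case: (posnP g) => [->|g0]; first by rewrite edges0 laminar_sub ?sub0set.
suff d : [disjoint edges z g & edges y h] by rewrite /laminar d !orbT.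
move: zint yz; rewrite !inE -leqNgt => zint gy.
rewrite (gap_rebase (vtx z)) gapxx in zint.
have yn := ltn_gap (vtx z) (vtx y).
have le_yh : gap (vtx z) (vtx y) + h <= n.
  rewrite leqNgt; apply/negP => lt_yh.
  have /(congr1 (gap (vtx z))) : vtx z = vtx y by apply: zint; case: ifP; lia.
  by rewrite gapxx; lia.
apply/pred0P => c /=; rewrite !inE (gap_rebase (vtx z) (vtx y)).
by have := ltn_gap (vtx z) c; case: ifP; lia.
Qed.

(** The intervals overlap properly: the edges at [z], [z + l] and [z + k] refute the two inclusions
    and disjointness. This excludes two different apexes over the same side. *)
Lemma crossing_edges z g k l : 0 < k < l -> l < g <= n ->
  ~~ laminar (edges z l) (edges (z + k) (g - k)).
Proof.
move=> kl lg; have kn : k < n by lia.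
have gk c : (c \in edges (z + k) (g - k)) = (k <= gap (vtx z) c < g).
  by rewrite inE gap_shift //; have := ltn_gap (vtx z) c; case: ifP; lia.
rewrite /laminar !negb_or; apply/and3P; split.
- apply/subsetPn; exists (vtx z); first by apply: mem_vtx_edges; lia.
  by rewrite gk gapxx; lia.
- apply/subsetPn; exists (vtx (z + l)); first by rewrite gk gap_vtx; lia.
  by rewrite inE gap_vtx; lia.
- apply/pred0Pn; exists (vtx (z + k)).
  by rewrite /= gk inE gap_vtx; lia.
Qed.

(** If [z] were not the first edge of [edges y h], its predecessor would belong to that set, but it
    lies outside the proper interval [edges z g]. *)
Lemma sub_edges_vtx z g y h : g < n -> h <= n -> edges y h \subset edges z g ->
  vtx z \in edges y h -> vtx y = vtx z.
Proof.
move=> gn hn /subsetP sub; rewrite inE; set i := gap _ _ => ih.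
have lt_in : i < n by apply: ltn_gap.
case: (posnP i) => i0; first by apply: (@gap_inj (vtx y)); rewrite gapxx -/i i0.
have /sub : vtx (y + i.-1) \in edges y h by rewrite inE gap_vtx; lia.
by rewrite inE (gap_rebase (vtx y)) -/i gap_vtx; [case: ifP | ]; lia.
Qed.

Lemma eq_vtxD z y h : vtx z = vtx y -> vtx (z + h) = vtx (y + h).
Proof.
move/(congr1 val) => /= e; apply: val_inj.
by rewrite /= -modnDml e modnDml.
Qed.

Lemma eq_edges z y h : vtx z = vtx y -> edges z h = edges y h.
Proof. by rewrite /edges => ->. Qed.

(** * Arcs as proper cyclic intervals *)

Definition arc z g : tarc n := inl (vtx z, vtx (z + g)).

Lemma arcDn z g : arc (z + n) g = arc z g.
Proof. by rewrite /arc addnAC !vtxDn. Qed.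

Lemma eq_arc z y h : vtx z = vtx y -> arc z h = arc y h.
Proof. by move=> e; rewrite /arc e (eq_vtxD h e). Qed.

Lemma valid_arcP a b : valid_arc (inl (a, b)) ->
  inl (a, b) = arc a (gap a b) /\ 1 < gap a b < n.
Proof.
move=> /andP[_ ->]; rewrite ltn_gap; split=> //.
by rewrite /arc -{4}(vtx_val a) vtx_gap vtx_val.
Qed.

Lemma valid_arc_gap z g : 1 < g < n -> valid_arc (arc z g).
Proof.
move=> gn; rewrite /= gap_vtx; last lia.
apply/andP; split; last lia.
by apply/eqP => /(congr1 (gap (vtx z))); rewrite gapxx gap_vtx; lia.
Qed.

Lemma compat_arc z g y h : g < n -> h < n ->
  compat (arc z g) (arc y h) = laminar (edges z g) (edges y h).
Proof. by move=> gn hn; rewrite /compat /= !edges_vtx. Qed.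

Lemma compat_arc_punct z g c e : g < n ->
  compat (arc z g) (inr (c, e)) = ((c \in edges z g) ==> (c == vtx z)).
Proof.
move=> gn; rewrite /= /interior gap_vtx // inE.
have -> : (c == vtx z) = (gap (vtx z) c == 0).
  apply/eqP/eqP => [->|e0]; first exact: gapxx.
  by apply: (@gap_inj (vtx z)); rewrite e0 gapxx.
by lia.
Qed.

Lemma compat_punct_arc z g c e :
  compat (inr (c, e)) (arc z g) = compat (arc z g) (inr (c, e)).
Proof. by []. Qed.

Lemma has_arcE D z g : has_arc D z (z + g) = (arc z g \in D).
Proof.
apply/existsP/idP => [[a /existsP[b /and3P[/eqP ea /eqP eb]]]|zgD].
  have -> : a = vtx z by apply: val_inj.
  by have -> : b = vtx (z + g) by apply: val_inj.
by exists (vtx z); apply/existsP; exists (vtx (z + g)); rewrite /= !eqxx.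
Qed.

(** * From trees to triangulations *)

Lemma bt_leaves_gt0 t : 0 < bt_leaves t.
Proof. by elim: t => //= l IHl r IHr; lia. Qed.

(* The regions (start, number of border edges) spanned by the subtrees of [t],
   leaves included, when the leftmost leaf of [t] is the border edge at [z]. *)
Fixpoint regs (t : bt) z : seq (nat * nat) :=
  (z, bt_leaves t) ::
  if t is Node l r then regs l z ++ regs r (z + bt_leaves l) else [::].

Fixpoint tops (s : rtree) z : seq (bt * nat) :=
  if s is t :: s' then (t, z) :: tops s' (z + bt_leaves t) else [::].

Definition rregs (s : rtree) z : seq (nat * nat) :=
  flatten [seq regs p.1 p.2 | p <- tops s z].

Lemma regs_root t z : (z, bt_leaves t) \in regs t z.
Proof. by case: t => [|l r]; rewrite inE eqxx. Qed.

Lemma regsN l r z p : p \in regs (Node l r) z ->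
  [\/ p = (z, bt_leaves l + bt_leaves r), p \in regs l z
    | p \in regs r (z + bt_leaves l)].
Proof.
rewrite inE mem_cat => /orP[/eqP ->|/orP[pl|pr]].
- exact: Or31.
- exact: Or32.
- exact: Or33.
Qed.

Lemma regs_gt0 t z p : p \in regs t z -> 0 < p.2.
Proof.
elim: t z => [|l IHl r IHr] z; first by rewrite inE => /eqP ->.
case/regsN => [->|/IHl //|/IHr //]; exact: (bt_leaves_gt0 (Node l r)).
Qed.

Lemma regs_le t z p : p \in regs t z -> p.2 <= bt_leaves t.
Proof.
elim: t z => [|l IHl r IHr] z; first by rewrite inE => /eqP ->.
by case/regsN => [->|/IHl|/IHr] //=; lia.
Qed.

Lemma sub_regs t z p : bt_leaves t <= n -> p \in regs t z ->
  edges p.1 p.2 \subset edges z (bt_leaves t).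
Proof.
elim: t z => [|l IHl r IHr] z tn; first by rewrite inE => /eqP ->.
have r0 := bt_leaves_gt0 r; move: tn => /= tn.
case/regsN => [->//|/IHl|/IHr] sub; rewrite edgesD //.
  by apply: subset_trans (subsetUl _ _); apply: sub; lia.
by apply: subset_trans (subsetUr _ _); apply: sub; lia.
Qed.

Lemma laminar_disjoint (X Y X' Y' : {set 'I_n}) :
  X \subset X' -> Y \subset Y' -> [disjoint X' & Y'] -> laminar X Y.
Proof.
by move=> XX' YY' d; rewrite /laminar (disjointWl XX' (disjointWr YY' d)) !orbT.
Qed.

Lemma regs_laminar t z p q : bt_leaves t <= n -> p \in regs t z -> q \in regs t z ->
  laminar (edges p.1 p.2) (edges q.1 q.2).
Proof.
elim: t z p q => [|l IHl r IHr] z p q tn.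
  by rewrite !inE => /eqP -> /eqP ->; rewrite /laminar subxx.
wlog: p q / p \in regs l z \/ q \in regs r (z + bt_leaves l).
  move=> W pt qt; case/regsN: (pt) => [pE|pl|pr]; last 1 first.
  - by rewrite laminarC; apply: W => //; right.
  - by rewrite laminarC pE; exact: laminar_sub (sub_regs tn qt).
  - by apply: W => //; left.
have r0 := bt_leaves_gt0 r; have tn' : bt_leaves l + bt_leaves r <= n by [].
case=> [pl pt qt|qr pt qt].
  case/regsN: (qt) => [qE|ql|qr].
  - by rewrite qE; exact: laminar_sub (sub_regs tn pt).
  - by apply: (IHl z) => //; lia.
  - have := disjoint_edges z tn'.
    by apply: laminar_disjoint; apply: sub_regs => //; lia.
case/regsN: (pt) => [pE|pl|pr].
- by rewrite laminarC pE; exact: laminar_sub (sub_regs tn qt).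
- have := disjoint_edges z tn'.
  by apply: laminar_disjoint; apply: sub_regs => //; lia.
- by apply: (IHr (z + bt_leaves l)) => //; lia.
Qed.

(** The regions of a right subtree avoid the first edge, so only those along the left spine contain
    it. Hence no arc of [t] passes over the puncture arc at [z]. *)
Lemma regs_vtx t z p : bt_leaves t <= n -> p \in regs t z ->
  vtx z \in edges p.1 p.2 -> vtx p.1 = vtx z.
Proof.
elim: t z => [|l IHl r IHr] z tn; first by rewrite inE => /eqP ->.
have r0 := bt_leaves_gt0 r; have l0 := bt_leaves_gt0 l; move: tn => /= tn.
case/regsN => [->//|pl|pr]; first by apply: IHl => //; lia.
move=> zp; have zr : vtx z \in edges (z + bt_leaves l) (bt_leaves r).
  by apply: subsetP zp; apply: sub_regs => //; lia.
by have /disjointFr/(_ (mem_vtx_edges z l0)) := disjoint_edges z tn; rewrite zr.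
Qed.

(** [Y] is compared with the two child regions. Inside one of them, induction applies; disjoint from
    one, it lies inside the other; containing both, it is the whole region. *)
Lemma regs_max t z (Y : {set 'I_n}) : bt_leaves t <= n -> Y != set0 ->
  Y \subset edges z (bt_leaves t) ->
  (forall p, p \in regs t z -> laminar Y (edges p.1 p.2)) ->
  exists2 p, p \in regs t z & Y = edges p.1 p.2.
Proof.
elim: t z => [|l IHl r IHr] z tn Y0 Yt lamY.
  exists (z, 1); first by rewrite inE.
  by move: Yt; rewrite /= edges1 subset1 (negPf Y0) orbF => /eqP.
have r0 := bt_leaves_gt0 r; have l0 := bt_leaves_gt0 l; move: tn Yt => /= tn.
rewrite edgesD // => Yt.
have memL p : p \in regs l z -> p \in regs (Node l r) z.
  by move=> pl; rewrite inE mem_cat pl orbT.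
have memR p : p \in regs r (z + bt_leaves l) -> p \in regs (Node l r) z.
  by move=> pr; rewrite inE mem_cat pr !orbT.
have inL : Y \subset edges z (bt_leaves l) ->
    exists2 p, p \in regs (Node l r) z & Y = edges p.1 p.2.
  move=> Yl; case: (IHl z _ Y0 Yl) => [||p /memL]; first lia.
    by move=> p /memL; apply: lamY.
  by exists p.
have inR : Y \subset edges (z + bt_leaves l) (bt_leaves r) ->
    exists2 p, p \in regs (Node l r) z & Y = edges p.1 p.2.
  move=> Yr; case: (IHr _ _ Y0 Yr) => [||p /memR]; first lia.
    by move=> p /memR; apply: lamY.
  by exists p.
have /or3P[/inL //|lY|Yl] := lamY _ (memL _ (regs_root l z)); last first.
  apply: inR; apply/subsetP => c cY; have := subsetP Yt c cY.
  by rewrite inE (disjointFr Yl cY).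
have /or3P[/inR //|rY|Yr] := lamY _ (memR _ (regs_root r _)); last first.
  apply: inL; apply/subsetP => c cY; have := subsetP Yt c cY.
  by rewrite inE (disjointFr Yr cY) orbF.
exists (z, bt_leaves l + bt_leaves r); first exact: (regs_root (Node l r)).
by apply/eqP; rewrite eqEsubset edgesD // Yt subUset lY rY.
Qed.

Lemma rregsP s z p : reflect
  (exists2 q, q \in tops s z & p \in regs q.1 q.2) (p \in rregs s z).
Proof.
by apply: (iffP flatten_mapP) => -[q qs pq]; exists q.
Qed.

(** * The subtrees at the root *)

Lemma rtree_leaves_cons t s : rtree_leaves (t :: s) = bt_leaves t + rtree_leaves s.
Proof. by []. Qed.

Lemma topsP s z q : q \in tops s z ->
  if s is t :: s' then q = (t, z) \/ q \in tops s' (z + bt_leaves t) else False.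
Proof. by case: s => [|t s] //=; rewrite inE => /orP[/eqP|]; [left|right]. Qed.

Lemma tops_le s z q : q \in tops s z -> bt_leaves q.1 <= rtree_leaves s.
Proof.
elim: s z => [|t s IHs] z // /topsP[->|/IHs]; rewrite rtree_leaves_cons /=; lia.
Qed.

Lemma sub_tops s z q : rtree_leaves s <= n -> q \in tops s z ->
  edges q.2 (bt_leaves q.1) \subset edges z (rtree_leaves s).
Proof.
elim: s z => [|t s IHs] z sn // /topsP qs.
rewrite rtree_leaves_cons in sn *; rewrite edgesD //.
case: qs => [->|qs]; first exact: subsetUl.
by apply: subset_trans (subsetUr _ _); apply: IHs => //; lia.
Qed.

Lemma tops_cover s z c : rtree_leaves s <= n -> c \in edges z (rtree_leaves s) ->
  exists2 q, q \in tops s z & c \in edges q.2 (bt_leaves q.1).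
Proof.
elim: s z => [|t s IHs] z sn; first by rewrite edges0 inE.
rewrite rtree_leaves_cons in sn *; rewrite edgesD // inE => /orP[cz|/IHs[]].
- by exists (t, z); rewrite // inE eqxx.
- lia.
- by move=> q qs cq; exists q; rewrite // inE qs orbT.
Qed.

Lemma tops_disjoint s z q q' : rtree_leaves s <= n ->
  q \in tops s z -> q' \in tops s z -> q = q' \/
  [disjoint edges q.2 (bt_leaves q.1) & edges q'.2 (bt_leaves q'.1)].
Proof.
elim: s z => [|t s IHs] z sn // /topsP qs /topsP qs'.
rewrite rtree_leaves_cons in sn; have d := disjoint_edges z sn.
have sn' : rtree_leaves s <= n by lia.
case: qs qs' => [->|qs] [->|qs']; first by left.
- by right; apply: disjointWr d; apply: sub_tops.
- by right; rewrite disjoint_sym; apply: disjointWr d; apply: sub_tops.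
- exact: (IHs (z + bt_leaves t)).
Qed.

(** The end of each top region is the start of another one, or the end of the whole sequence, which
    wraps around to [z] when there are [n] leaves. *)
Lemma tops_next s z q : q \in tops s z ->
  q.2 + bt_leaves q.1 = z + rtree_leaves s \/
  exists2 q', q' \in tops s z & q'.2 = q.2 + bt_leaves q.1.
Proof.
elim: s z => [|t s IHs] z // /topsP[->|qs].
  case: s {IHs} => [|t' s] /=; first by left; rewrite rtree_leaves_cons addn0.
  by right; exists (t', z + bt_leaves t); rewrite // !inE eqxx orbT.
case: (IHs _ qs) => [->|[q' qs' e]]; first by left; rewrite rtree_leaves_cons addnA.
by right; exists q'; rewrite // inE qs' orbT.
Qed.

(* The second family of puncture arcs carries the tag [~~ e] when the root has a
   single child and repeats the first family otherwise. *)
Definition arcs_of s z (e : bool) : seq (tarc n) :=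
  [seq arc p.1 p.2 | p <- rregs s z & 1 < p.2 < n] ++
  [seq inr (vtx q.2, e) | q <- tops s z] ++
  [seq inr (vtx q.2, (size s == 1) (+) e) | q <- tops s z].

Definition tri_of s z e : {set tarc n} := [set w in arcs_of s z e].

Variant tri_of_spec s z (e : bool) : tarc n -> Prop :=
  | TriOfArc p of p \in rregs s z & 1 < p.2 < n : tri_of_spec s z e (arc p.1 p.2)
  | TriOfPunct q (b : bool) of q \in tops s z & (size s == 1) || (b == e) :
      tri_of_spec s z e (inr (vtx q.2, b)).

Lemma tri_ofP s z e w : w \in tri_of s z e -> tri_of_spec s z e w.
Proof.
rewrite inE !mem_cat => /or3P[] /mapP[].
- by move=> p; rewrite mem_filter => /andP[p2 pr] ->; apply: TriOfArc.
- by move=> q qs ->; apply: TriOfPunct; rewrite ?eqxx ?orbT.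
- by move=> q qs ->; apply: TriOfPunct => //; case: eqP => //=.
Qed.

Lemma arc_tri_of s z e p : p \in rregs s z -> 1 < p.2 < n ->
  arc p.1 p.2 \in tri_of s z e.
Proof.
move=> pr p2; rewrite inE !mem_cat; apply/orP; left.
by apply: (map_f (fun p => arc p.1 p.2)); rewrite mem_filter p2.
Qed.

Lemma punct_tri_of s z e q (b : bool) : q \in tops s z -> (size s == 1) || (b == e) ->
  inr (vtx q.2, b) \in tri_of s z e.
Proof.
move=> qs be; rewrite inE !mem_cat; apply/orP; right; apply/orP.
have [->|nbe] := eqVneq b e.
  by left; apply: (map_f (fun q => inr (vtx q.2, e))).
right; move: be; rewrite (negPf nbe) orbF => ->.
have -> : b = true (+) e by case: b e nbe => [] [].
by apply: (map_f (fun q => inr (vtx q.2, true (+) e))).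
Qed.

Lemma rregs_laminar s z p p' : rtree_leaves s <= n ->
  p \in rregs s z -> p' \in rregs s z ->
  laminar (edges p.1 p.2) (edges p'.1 p'.2).
Proof.
move=> sn /rregsP[q qs pq] /rregsP[q' qs' pq'].
have qn := leq_trans (tops_le qs) sn; have qn' := leq_trans (tops_le qs') sn.
case: (tops_disjoint sn qs qs') => [eq|].
  by rewrite -eq in pq'; apply: regs_laminar pq'.
by apply: laminar_disjoint; apply: sub_regs.
Qed.

Lemma rregs_vtx s z p q : rtree_leaves s <= n ->
  p \in rregs s z -> q \in tops s z -> vtx q.2 \in edges p.1 p.2 ->
  vtx p.1 = vtx q.2.
Proof.
move=> sn /rregsP[q' qs' pq'] qs qp.
have qn' := leq_trans (tops_le qs') sn.
case: (tops_disjoint sn qs qs') => [eq|d].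
  by rewrite -eq in pq' qn'; apply: (regs_vtx qn' pq' qp).
have := disjointFr d (mem_vtx_edges q.2 (bt_leaves_gt0 q.1)).
by rewrite (subsetP (sub_regs qn' pq')).
Qed.

Lemma tops_lt s z q : size s != 1 -> q \in tops s z ->
  bt_leaves q.1 < rtree_leaves s.
Proof.
case: s => [|t [|t' s]] // _ /topsP[->|/tops_le]; rewrite !rtree_leaves_cons /=.
  by have := bt_leaves_gt0 t'; lia.
by have := bt_leaves_gt0 t; lia.
Qed.

(** For maximality, a border arc compatible with everything is confined by the puncture arcs to a
    single top region, where [regs_max] identifies it with a subtree. A compatible puncture arc is
    forced to the start of a top region. *)
Lemma tri_of_triangulation s z e : rtree_leaves s = n ->
  triangulation (tri_of s z e).
Proof.
move=> sn; have sn' : rtree_leaves s <= n by rewrite sn.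
split.
- by move=> _ /tri_ofP[p _ p2|//]; apply: valid_arc_gap.
- move=> _ _ /tri_ofP[p ps p2|q b qs be] /tri_ofP[p' ps' p2'|q' b' qs' be'].
  + by rewrite compat_arc ?(rregs_laminar sn' ps ps') //; lia.
  + rewrite compat_arc_punct; last lia.
    by apply/implyP => /(rregs_vtx sn' ps qs') ->.
  + rewrite compat_punct_arc compat_arc_punct; last lia.
    by apply/implyP => /(rregs_vtx sn' ps' qs) ->.
  + rewrite /=; have [s1|s1] := eqVneq (size s) 1; last first.
      by move: be be'; rewrite (negPf s1) => /eqP -> /eqP ->; rewrite eqxx orbT.
    case: (s) s1 qs qs' => [|t [|]] //= _.
    by rewrite !inE => /eqP -> /eqP ->; rewrite eqxx.
case=> [[a b]|[c b]] vw cw.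
  have [wE ab] := valid_arcP vw; rewrite wE in cw *.
  set g := gap a b in ab cw *; have gn : g < n by lia.
  have [q qs aq] : exists2 q, q \in tops s z & a \in edges q.2 (bt_leaves q.1).
    by apply: (tops_cover sn'); rewrite sn edges_full inE.
  have qn := leq_trans (tops_le qs) sn'.
  have sub : edges a g \subset edges q.2 (bt_leaves q.1).
    have [qn1|qnn] := eqVneq (bt_leaves q.1) n; first by rewrite qn1 edges_full subsetT.
    apply: sub_edges; [by rewrite ltn_neqAle qnn | by rewrite vtx_val |].
    (* The puncture arc at the start of the cyclically next region keeps [arc a g] from passing the
       end of this one. *)
    have [q' qs' ->] : exists2 q', q' \in tops s z & vtx (q.2 + bt_leaves q.1) = vtx q'.2.
      case: (tops_next qs) => [->|[q' qs' eq]]; last by exists q'; rewrite ?eq.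
      rewrite sn vtxDn; case: (s) sn => [|t s'] => [|_].
        by rewrite /rtree_leaves /=; lia.
      by exists (t, z); rewrite // inE eqxx.
    have : compat (arc a g) (inr (vtx q'.2, e)).
      by apply/cw/punct_tri_of; rewrite ?eqxx ?orbT.
    by rewrite compat_arc_punct // => /implyP h /h/eqP.
  have lam p : p \in regs q.1 q.2 -> laminar (edges a g) (edges p.1 p.2).
    move=> pq; have p0 := regs_gt0 pq; have pn := leq_trans (regs_le pq) qn.
    have [->|p1] := eqVneq p.2 1; first by rewrite edges1 laminar1.
    have [->|pn'] := eqVneq p.2 n; first by rewrite edges_full laminarT.
    have p1n : 1 < p.2 < n by lia.
    rewrite -compat_arc //; last lia.
    by apply/cw/arc_tri_of => //; apply/rregsP; exists q.
  have [] := regs_max qn _ sub lam.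
    by apply/set0Pn; exists (vtx a); apply: mem_vtx_edges; lia.
  move=> p pq eq; have pn : 0 < p.2 < n.
    rewrite (regs_gt0 pq) /= ltn_neqAle (leq_trans (regs_le pq) qn) andbT.
    (* An arc misses the border edge starting at its end vertex, so it cannot span the full
       boundary. *)
    apply/eqP => p2n; move/setP/(_ (vtx (a + g))): eq.
    by rewrite p2n edges_full !inE gap_vtx // ltnn.
  have [] := edges_inj _ pn eq; first lia.
  move=> av gp; have -> : arc a g = arc p.1 p.2.
    rewrite /arc av gp; congr (inl (_, _)); apply: (@gap_inj (vtx a)).
    by rewrite {2}av !gap_vtx //; lia.
  by apply: arc_tri_of; [apply/rregsP; exists q | lia].
have cw' q : q \in tops s z -> compat (inr (c, b)) (inr (vtx q.2, e)).
  by move=> qs; apply/cw/punct_tri_of; rewrite ?eqxx ?orbT.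
(* A lone puncture vertex carries both tags, and the one opposite to [b] forces [c] to be that
   vertex. *)
have [s1|s1] := eqVneq (size s) 1.
  have [q qs _] : exists2 q, q \in tops s z & vtx z \in edges q.2 (bt_leaves q.1).
    by apply: (tops_cover sn'); rewrite sn edges_full inE.
  have /cw /= : inr (vtx q.2, ~~ b) \in tri_of s z e.
    by apply: punct_tri_of; rewrite ?s1.
  rewrite (_ : b == ~~ b = false) ?orbF; last by case: (b).
  by move/eqP ->; apply: punct_tri_of; rewrite ?s1.
have [q qs cq] : exists2 q, q \in tops s z & c \in edges q.2 (bt_leaves q.1).
  by apply: (tops_cover sn'); rewrite sn edges_full inE.
(* The region of [c] is either a single edge or spanned by a border arc, which no puncture arc may
   cross. *)
have cE : c = vtx q.2.
  have [q1|q1] := eqVneq (bt_leaves q.1) 1; first by apply/set1P; rewrite -edges1 -q1.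
  have qn : bt_leaves q.1 < n by rewrite -sn; apply: tops_lt qs.
  have /cw : arc q.2 (bt_leaves q.1) \in tri_of s z e.
    apply: (@arc_tri_of _ _ _ (q.2, bt_leaves q.1)).
      by apply/rregsP; exists q => //; apply: regs_root.
    by rewrite /= qn andbT ltn_neqAle eq_sym q1 bt_leaves_gt0.
  by rewrite compat_punct_arc compat_arc_punct // cq => /eqP.
rewrite cE; apply: punct_tri_of; rewrite // (negPf s1) /=.
(* A puncture vertex other than [c] forces the tag [e]. The first two subtrees start at different
   vertices, so one of them provides it. *)
have [q' qs' ne] : exists2 q', q' \in tops s z & vtx q'.2 != c.
  case: (s) s1 sn => [|t [|t' s']] //.
    by move=> _; rewrite /rtree_leaves /=; lia.
  rewrite !rtree_leaves_cons => _ sn1.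
  have [ez|] := eqVneq (vtx z) c; last by exists (t, z); rewrite // inE eqxx.
  exists (t', z + bt_leaves t); first by rewrite !inE eqxx orbT.
  rewrite -ez; apply/eqP => /(congr1 (gap (vtx z))).
  have t0 := bt_leaves_gt0 t; have t0' := bt_leaves_gt0 t'.
  by rewrite gapxx /= gap_vtx; lia.
by have := cw' _ qs'; rewrite /= eq_sym (negPf ne).
Qed.

(** * Change of start, of tag and of the first subtree *)

Lemma regsD t z k : regs t (z + k) = [seq (p.1 + k, p.2) | p <- regs t z].
Proof.
elim: t z => [|l IHl r IHr] z //=.
by rewrite map_cat -IHl -IHr addnAC.
Qed.

Lemma topsD s z k : tops s (z + k) = [seq (q.1, q.2 + k) | q <- tops s z].
Proof. by elim: s z => //= t s IHs z; rewrite -IHs addnAC. Qed.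

Lemma rregsD s z k : rregs s (z + k) = [seq (p.1 + k, p.2) | p <- rregs s z].
Proof.
rewrite /rregs topsD map_flatten -!map_comp; congr flatten.
by apply: eq_map => q /=; rewrite regsD.
Qed.

Lemma arcs_ofS s z e : arcs_of s z.+1 e = [seq rot_arc w | w <- arcs_of s z e].
Proof.
rewrite /arcs_of -[z.+1]addn1 rregsD topsD !map_cat -!map_comp; congr (_ ++ (_ ++ _)).
- rewrite filter_map -map_comp; apply: eq_map => p.
  by rewrite /= !shiftv_vtx /arc addn1 addSn.
- by apply: eq_map => q; rewrite /= shiftv_vtx addn1.
- by apply: eq_map => q; rewrite /= shiftv_vtx addn1.
Qed.

Lemma arcs_ofN s z e : arcs_of s z (~~ e) = [seq inv_arc w | w <- arcs_of s z e].
Proof.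
rewrite /arcs_of !map_cat -!map_comp; congr (_ ++ (_ ++ _)); apply: eq_map => q //=.
by rewrite addbN.
Qed.

Lemma tri_of_map (f : tarc n -> tarc n) s z e s' z' e' :
  arcs_of s' z' e' = [seq f w | w <- arcs_of s z e] ->
  tri_of s' z' e' = f @: tri_of s z e.
Proof.
move=> E; apply/setP => w; rewrite inE E; apply/mapP/imsetP => -[u us ->].
  by exists u; rewrite ?inE.
by exists u; move: us; rewrite ?inE.
Qed.

Lemma tri_equiv_shift s z k e : tri_equiv (tri_of s z e) (tri_of s (z + k) e).
Proof.
elim: k => [|k IHk]; first by rewrite addn0; apply: rst_refl.
apply: rst_trans IHk _; apply: rst_step; left; rewrite addnS.
exact/tri_of_map/arcs_ofS.
Qed.

Lemma tri_equiv_tri_of s z z' e e' : tri_equiv (tri_of s z e) (tri_of s z' e').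
Proof.
have eqz y : tri_equiv (tri_of s y e) (tri_of s 0 e).
  by apply: rst_sym; apply: (tri_equiv_shift s 0).
apply: rst_trans (eqz z) _; apply: rst_trans (rst_sym _ _ _ _ (eqz z')) _.
have [->|ne] := eqVneq e e'; first exact: rst_refl.
apply: rst_step; right; apply: tri_of_map; rewrite -arcs_ofN; congr arcs_of.
by clear eqz; case: e e' ne => [] [].
Qed.

Lemma tops_rcons s t z : tops (rcons s t) z = rcons (tops s z) (t, z + rtree_leaves s).
Proof.
elim: s z => [|t' s IHs] z /=; first by rewrite addn0.
by rewrite IHs rtree_leaves_cons addnA.
Qed.

(** Moving the first subtree to the end shifts its start by [n], which changes none of its arcs. A
    rotation of the root is thus absorbed by a change of start. *)
Lemma tri_of_rot1 t s z e : rtree_leaves (t :: s) = n ->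
  tri_of (rcons s t) (z + bt_leaves t) e = tri_of (t :: s) z e.
Proof.
rewrite rtree_leaves_cons => sn; apply/setP => w; rewrite !inE !mem_cat.
have topsE : tops (rcons s t) (z + bt_leaves t) =
    rcons (tops s (z + bt_leaves t)) (t, z + n).
  by rewrite tops_rcons -addnA sn.
have puncE (b : bool) :
    (w \in [seq inr (vtx q.2, b) | q <- tops (rcons s t) (z + bt_leaves t)])
    = (w \in [seq inr (vtx q.2, b) | q <- tops (t :: s) z]).
  by rewrite topsE map_rcons mem_rcons /= vtxDn.
rewrite size_rcons !puncE; congr (_ || _).
rewrite /rregs topsE map_rcons flatten_rcons filter_cat map_cat mem_cat orbC.
rewrite [tops (t :: s) z]/= [map _ (_ :: _)]/= [flatten (_ :: _)]/=.
rewrite filter_cat map_cat mem_cat; congr (_ || _).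
rewrite [(t, _).1]/= [(t, _).2]/= regsD filter_map -map_comp.
by congr (w \in _); apply: eq_map => p /=; rewrite arcDn.
Qed.

Lemma rtree_leaves_rot k s : rtree_leaves (rot k s) = rtree_leaves s.
Proof. by rewrite /rtree_leaves map_rot /rot sumn_cat addnC -sumn_cat cat_take_drop. Qed.

Lemma tri_equiv_rot k s z z' e e' : rtree_leaves s = n ->
  tri_equiv (tri_of s z e) (tri_of (rot k s) z' e').
Proof.
move=> sn; have [ks|sk] := leqP k (size s); last first.
  by rewrite rot_oversize 1?ltnW //; apply: tri_equiv_tri_of.
elim: k ks z' => [|k IHk] ks z'; first by rewrite rot0; apply: tri_equiv_tri_of.
apply: rst_trans (IHk (ltnW ks) 0) _; rewrite rotS //.
have := rtree_leaves_rot k s; case: (rot k s) => [|t u].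
  by move=> _; apply: tri_equiv_tri_of.
rewrite sn => un; rewrite rot1_cons -(tri_of_rot1 0 e' un); exact: tri_equiv_tri_of.
Qed.

(** * The tree of a triangulation *)

Lemma side_okE D z g : side_ok D z g = (g == 1) || (arc z g \in D).
Proof. by rewrite /side_ok has_arcE. Qed.

(** The default value [1] lies in the range as well, so [cap_tree] has the right number of leaves
    for every set [D]. *)
Lemma head_filter_iota (P : pred nat) g :
  1 < g -> 0 < head 1 [seq k <- iota 1 g.-1 | P k] < g.
Proof.
move=> g1; case E: [seq k <- _ | _] => [|k s] //=.
have : k \in [seq k <- iota 1 g.-1 | P k] by rewrite E inE eqxx.
by rewrite mem_filter mem_iota => /andP[_]; lia.
Qed.

Lemma head_filter_uniq (P : pred nat) s k (x0 : nat) : k \in s -> P k ->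
  (forall k', k' \in s -> P k' -> k' = k) -> head x0 [seq k <- s | P k] = k.
Proof.
move=> ks Pk u; have : k \in [seq k <- s | P k] by rewrite mem_filter Pk.
case E: [seq k <- _ | _] => [|k' s'] //= _.
have : k' \in [seq k <- s | P k] by rewrite E inE eqxx.
by rewrite mem_filter => /andP[Pk' /u->].
Qed.

Definition apex D z g :=
  head 1 [seq k <- iota 1 g.-1 | side_ok D z k && side_ok D (z + k) (g - k)].

Lemma cap_treeS D m z g : 1 < g ->
  cap_tree D m.+1 z g = Node (cap_tree D m z (apex D z g))
                             (cap_tree D m (z + apex D z g) (g - apex D z g)).
Proof. by rewrite ltnNge /= => /negPf ->. Qed.

Lemma leaves_cap_tree D m z g : 0 < g <= m -> bt_leaves (cap_tree D m z g) = g.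
Proof.
elim: m z g => [|m IHm] z g gm; first lia.
have [g1|g1] := leqP g 1; first by rewrite /= g1 /=; lia.
rewrite cap_treeS //=; have : 0 < apex D z g < g by apply: head_filter_iota.
by move=> kg; rewrite !IHm; lia.
Qed.

(** The split at the root of [t] is an admissible apex. Any other apex has a side that crosses one
    of the two sides of this split, by [crossing_edges], so [cap_tree] finds the same split. *)
Lemma cap_tree_regs D t m z :
  (forall u w, u \in D -> w \in D -> compat u w) ->
  (forall p, p \in regs t z -> 1 < p.2 < n -> arc p.1 p.2 \in D) ->
  bt_leaves t <= m -> bt_leaves t <= n -> cap_tree D m z (bt_leaves t) = t.
Proof.
move=> Dc; elim: t m z => [|l IHl r IHr] [|m] z Dt tm tn //.
  by move: tm => /=; have := bt_leaves_gt0 l; lia.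
have l0 := bt_leaves_gt0 l; have r0 := bt_leaves_gt0 r.
have DL p : p \in regs l z -> 1 < p.2 < n -> arc p.1 p.2 \in D.
  by move=> pl; apply: Dt; rewrite inE mem_cat pl orbT.
have DR p : p \in regs r (z + bt_leaves l) -> 1 < p.2 < n -> arc p.1 p.2 \in D.
  by move=> pr; apply: Dt; rewrite inE mem_cat pr !orbT.
rewrite /= in tm tn.
have kE : apex D z (bt_leaves l + bt_leaves r) = bt_leaves l.
  apply: head_filter_uniq; first by rewrite mem_iota; lia.
    rewrite !side_okE addKn; apply/andP; split; apply/orP.
      case: eqVneq => [|l1]; [by left | right].
      by apply: (DL _ (regs_root l z)) => /=; lia.
    case: eqVneq => [|r1]; [by left | right].
    by apply: (DR _ (regs_root r _)) => /=; lia.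
  move=> k; rewrite mem_iota => kI; rewrite !side_okE => /andP[kz kg].
  case: (ltngtP k (bt_leaves l)) => // kl.
    have kl1 : bt_leaves l != 1 by lia.
    have kg1 : (bt_leaves l + bt_leaves r - k == 1) = false by lia.
    have lD : arc z (bt_leaves l) \in D.
      by apply: (DL _ (regs_root l z)) => /=; lia.
    move: kg; rewrite kg1 /= => kg.
    have := Dc _ _ lD kg; rewrite compat_arc; [|lia..].
    move=> lam; have := @crossing_edges z (bt_leaves l + bt_leaves r) k (bt_leaves l).
    by rewrite lam //; lia.
  have kz1 : (k == 1) = false by lia.
  have rD : arc (z + bt_leaves l) (bt_leaves r) \in D.
    by apply: (DR _ (regs_root r _)) => /=; lia.
  move: kz; rewrite kz1 /= => kz.
  have := Dc _ _ kz rD; rewrite compat_arc; [|lia..].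
  move=> lam; have := @crossing_edges z (bt_leaves l + bt_leaves r) (bt_leaves l) k.
  by rewrite addKn lam //; lia.
rewrite [bt_leaves _]/= cap_treeS ?kE ?addKn; last lia.
by rewrite IHl ?IHr //; lia.
Qed.

(** * The tree of [tri_of] *)

Lemma mem_punct_verts D z : z \in punct_verts D <->
  z < n /\ exists e, inr (vtx z, e) \in D.
Proof.
split=> [/mapP[c] | [zn [e ze]]].
  rewrite mem_filter => /andP[/existsP[e ce] _] ->.
  by split; [exact: ltn_ord | exists e; rewrite vtx_val].
apply/mapP; exists (vtx z); last by rewrite /= modn_small.
by rewrite mem_filter mem_enum andbT; apply/existsP; exists e.
Qed.

Lemma punct_verts_sorted D : sorted ltn (punct_verts D).
Proof.
rewrite /punct_verts; apply: (subseq_sorted ltn_trans (map_subseq _ (filter_subseq _ _))).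
by rewrite val_enum_ord iota_ltn_sorted.
Qed.

Lemma tops_path s z z' : z' < z -> path ltn z' [seq q.2 | q <- tops s z].
Proof.
elim: s z z' => [|t s IHs] z z' zz' //=; rewrite zz' /=; apply: IHs.
by have := bt_leaves_gt0 t; lia.
Qed.

Lemma tops_sorted s z : sorted ltn [seq q.2 | q <- tops s z].
Proof.
case: s => //= t s; apply: tops_path.
by have := bt_leaves_gt0 t; lia.
Qed.

Lemma tops_bound s z q : q \in tops s z ->
  z <= q.2 /\ q.2 + bt_leaves q.1 <= z + rtree_leaves s.
Proof.
elim: s z => [|t s IHs] z // /topsP[->|/IHs]; rewrite rtree_leaves_cons /=; lia.
Qed.

(** Starting at [0] keeps all positions below [n], so both sides are strictly increasing lists with
    the same elements. *)
Lemma punct_verts_tri_of s e : rtree_leaves s = n ->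
  punct_verts (tri_of s 0 e) = [seq q.2 | q <- tops s 0].
Proof.
move=> sn; apply: (irr_sorted_eq ltn_trans ltnn).
- exact: punct_verts_sorted.
- exact: tops_sorted.
have tn q : q \in tops s 0 -> q.2 < n.
  by move/tops_bound; have := bt_leaves_gt0 q.1; lia.
move=> z; apply/idP/mapP => [/mem_punct_verts[zn [b zb]]|[q qs ->]].
  move E: (inr (vtx z, b)) (tri_ofP zb) => w wP.
  case: wP E => // q b' qs _ [E _]; exists q => //.
  by move: E; rewrite !modn_small // tn.
apply/mem_punct_verts; split; first exact: tn.
by exists e; apply: punct_tri_of; rewrite ?eqxx ?orbT.
Qed.

Lemma zip_tops s z :
  zip [seq q.2 | q <- tops s z]
      (rcons (behead [seq q.2 | q <- tops s z]) (z + rtree_leaves s)) =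
  [seq (q.2, q.2 + bt_leaves q.1) | q <- tops s z].
Proof.
elim: s z => [|t s IHs] z //=; rewrite rtree_leaves_cons addnA.
have := IHs (z + bt_leaves t).
by case: s {IHs} => [|t' s] /=; [rewrite addn0 | move=> ->].
Qed.

Lemma map_fst_tops s z : [seq q.1 | q <- tops s z] = s.
Proof. by elim: s z => //= t s IHs z; rewrite IHs. Qed.

(** Since [punct_verts] and [tops s 0] list the subtrees in the same order, [s] itself is recovered
    and not just its class. Surjectivity follows. *)
Lemma sigma_tri_of s e : rtree_leaves s = n -> sigma (tri_of s 0 e) = s.
Proof.
move=> sn; rewrite /sigma punct_verts_tri_of //.
have -> : head 0 [seq q.2 | q <- tops s 0] = 0 by case: (s).
rewrite -[X in rcons _ (0 + X)]sn zip_tops -map_comp -[RHS](map_fst_tops s 0).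
have [_ Dc _] := tri_of_triangulation 0 e sn.
have sn' : rtree_leaves s <= n by rewrite sn.
apply/eq_in_map => q qs; have qn := leq_trans (tops_le qs) sn'.
rewrite /= addKn; apply: cap_tree_regs => // p pq p2.
by apply: arc_tri_of => //; apply/rregsP; exists q.
Qed.

(* The sides whose outer regions [cap_tree] explores; [g = n] is the loop of a
   self-folded triangle, which is not an element of [D]. *)
Definition region D z g :=
  0 < g < n /\ side_ok D z g \/
  g = n /\ (exists e, inr (vtx z, e) \in D) /\
           forall c e, inr (c, e) \in D -> c = vtx z.

Lemma region_punct D z g c e : triangulation D -> region D z g ->
  inr (c, e) \in D -> c \in edges z g -> c = vtx z.
Proof.
move=> [_ Dc _] [[gn]|[_ [_ Dz]] cD _]; last exact: Dz cD.
rewrite side_okE => /orP[/eqP->|gD] cD; first by rewrite edges1 => /set1P.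
have := Dc _ _ gD cD; rewrite compat_arc_punct; last lia.
by move=> /implyP h /h/eqP.
Qed.

(** The second claim is [sub_edges_vtx] when [g < n]. For the full boundary the inclusion carries no
    information, and the puncture arc at [z] stops [arc y h] from passing through [z]. *)
Lemma region_arc D z g y h : triangulation D -> region D z g ->
  1 < h < n -> arc y h \in D ->
  laminar (edges y h) (edges z g) /\
  (edges y h \subset edges z g -> vtx z \in edges y h -> vtx y = vtx z).
Proof.
move=> [_ Dc _] [[gn gD]|[-> [[e ze] _]]] hn hD; last first.
  rewrite edges_full laminarT; split=> // _ zy.
  have := Dc _ _ hD ze; rewrite compat_arc_punct; last lia.
  by rewrite zy => /eqP.
split; last by apply: sub_edges_vtx; lia.
move: gD; rewrite side_okE => /orP[/eqP->|gD]; first by rewrite edges1 laminar1.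
by have := Dc _ _ hD gD; rewrite compat_arc //; lia.
Qed.

(** The apex is the end of the longest side from [z] that is shorter than [g]. The side closing the
    triangle crosses nothing in [D], so it belongs to [D] by maximality. *)
Lemma apex_exists D z g : triangulation D -> region D z g -> 1 < g ->
  exists2 k, 0 < k < g & side_ok D z k && side_ok D (z + k) (g - k).
Proof.
move=> Dt rg g1; have [Dv Dc Dm] := Dt.
have gn : g <= n by case: rg => [[]|[]]; lia.
pose P k := (0 < k < g) && side_ok D z k.
(* The border edge at [z] is always a candidate. *)
have exP : exists k, P k by exists 1; rewrite /P g1 side_okE.
have leP k : P k -> k <= g by rewrite /P; lia.
case: (ex_maxnP exP leP) => k /andP[kg kz] kmax.
exists k => //; rewrite kz side_okE; apply/orP.
case: eqVneq => [|gk1]; [by left | right].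
have gk : 1 < g - k < n by lia.
have gkE : k + (g - k) = g by lia.
have gE : edges z g = edges z k :|: edges (z + k) (g - k).
  by rewrite -edgesD gkE.
have dis : [disjoint edges z k & edges (z + k) (g - k)].
  by apply: disjoint_edges; rewrite gkE.
have kg' : 0 < k by lia.
apply: Dm; first exact: valid_arc_gap.
case=> [[a b]|[c e]] wD; last first.
  rewrite compat_arc_punct; last lia.
  apply/implyP => cg; have cz : c = vtx z.
    by apply: (region_punct Dt rg wD); rewrite gE inE cg orbT.
  by have := disjointFr dis (mem_vtx_edges z kg'); rewrite -cz cg.
have [wE hn] := valid_arcP (Dv _ wD); rewrite wE in wD *.
move: (nat_of_ord a) (gap a b) hn wD => y h hn wD {wE a b}.
rewrite compat_arc; [|lia..].
have [lam startz] := region_arc Dt rg hn wD.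
case/or3P: lam => [yz|zy|d]; last first.
- have d' : [disjoint edges (z + k) (g - k) & edges y h].
    by rewrite disjoint_sym; apply: disjointWr d; rewrite gE subsetUr.
  by rewrite /laminar d' !orbT.
- by apply/laminar_sub/(subset_trans _ zy); rewrite gE subsetUr.
have : laminar (edges y h) (edges z k).
  move: kz; rewrite side_okE => /orP[/eqP->|kD]; first by rewrite edges1 laminar1.
  by have := Dc _ _ wD kD; rewrite compat_arc //; lia.
case/or3P => [yk|ky|d]; last first.
- rewrite laminarC; apply/laminar_sub/subsetP => c cy.
  by have := subsetP yz c cy; rewrite gE inE (disjointFr d cy).
(* An arc of [D] within the region that contains the longest side also starts at [z]. It then spans
   the whole region or, by the choice of [k], stays within the longest side. *)
- have yzE := startz yz (subsetP ky _ (mem_vtx_edges z kg')).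
  rewrite (eq_edges h yzE) (eq_arc h yzE) in yz ky wD *.
  have hg : h <= g.
    have /(subsetP yz) : vtx (z + h.-1) \in edges z h by rewrite inE gap_vtx; lia.
    by rewrite inE gap_vtx; lia.
  have [->|hg'] := eqVneq h g; first by apply/laminar_sub; rewrite gE subsetUr.
  have hk : h <= k by apply: kmax; rewrite /P side_okE wD orbT; lia.
  rewrite laminarC; apply: laminar_disjoint dis => //; apply/subsetP => c.
  by rewrite !inE; lia.
- by rewrite laminarC; apply: laminar_disjoint dis.
Qed.

Lemma apexP D z g : triangulation D -> region D z g -> 1 < g ->
  [/\ 0 < apex D z g < g, region D z (apex D z g)
    & region D (z + apex D z g) (g - apex D z g)].
Proof.
move=> Dt rg g1; have gn : g <= n by case: rg => [[]|[]]; lia.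
have [k kg Pk] := apex_exists Dt rg g1.
have : apex D z g \in [seq k <- iota 1 g.-1 | side_ok D z k && side_ok D (z + k) (g - k)].
  have : k \in [seq k <- iota 1 g.-1 | side_ok D z k && side_ok D (z + k) (g - k)].
    by rewrite mem_filter Pk mem_iota; lia.
  by rewrite /apex; case: [seq _ <- _ | _] => //= k' s _; rewrite inE eqxx.
rewrite mem_filter mem_iota => /andP[/andP[kz kgz] ak].
by split; [lia | left; split=> //; lia..].
Qed.

Lemma regs_cap_tree D m z g p : triangulation D -> region D z g -> g <= m ->
  p \in regs (cap_tree D m z g) z -> 1 < p.2 < n -> arc p.1 p.2 \in D.
Proof.
move=> Dt; elim: m z g => [|m IHm] z g rg gm.
  by move=> /regs_le /=; lia.
have [g1|g1] := leqP g 1; first by rewrite /= g1 inE => /eqP -> /=; lia.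
have [ag rl rr] := apexP Dt rg g1.
rewrite cap_treeS // => /regsN; rewrite !leaves_cap_tree; [|lia..].
case=> [->|pl|pr];
  [rewrite /= | by apply: IHm pl => //; lia | by apply: IHm pr => //; lia].
rewrite subnKC; last lia.
by case: rg => [[gn]|[]]; [rewrite side_okE => /orP[/eqP|//] | ]; lia.
Qed.

(** Otherwise let [a] be the start of a border arc of [D] spanning the most edges. An arc of [D]
    over the border edge at [a] is contained in the longest one or equal to it, hence starts at [a].
    So a puncture arc at [a] crosses nothing and must be in [D]. If [D] has no border arc either,
    any puncture arc will do. *)
Lemma punct_exists D : triangulation D -> exists c e, inr (c, e) \in D.
Proof.
move=> [Dv Dc Dm].
case: (boolP [exists c : 'I_n, [exists e : bool, inr (c, e) \in D]]).
  by case/existsP => c /existsP[e]; exists c, e.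
move=> /existsPn nD.
have noP c e : inr (c, e) \notin D by have /existsPn := nD c; apply.
pose Q (w : 'I_n * 'I_n) := inl w \in D.
case: (pickP Q) => [w0 Qw0|Q0]; last first.
  exists (vtx 0), true; apply: Dm => // -[w|[c e]] wD.
    by have := Q0 w; rewrite /Q wD.
  by have := noP c e; rewrite wD.
have [[a b] abD maxw] := @arg_maxnP _ w0 Q (fun w => gap w.1 w.2) Qw0.
exists a, true; apply: Dm => // -[[c d]|[c e]] wD; last by have := noP c e; rewrite wD.
have [E gn] := valid_arcP (Dv _ abD); have [E' hn] := valid_arcP (Dv _ wD).
have /= hg := maxw _ wD.
change (is_true (compat (inr (a, true)) (inl (c, d)))).
have := Dc _ _ abD wD; rewrite E' compat_punct_arc.
rewrite compat_arc_punct; last lia.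
rewrite E compat_arc; [|lia..].
set g := gap a b in gn hg E *; set h := gap c d in hn hg E' *.
rewrite -[X in X \in _](vtx_val a) -[X in X == _](vtx_val a).
move=> lam; apply/implyP => ac; apply/eqP.
have aE : vtx a \in edges a g by apply: mem_vtx_edges; lia.
case/or3P: lam => [ss|ss|dd]; last by rewrite (disjointFr dd aE) in ac.
- have /eqP eE : edges a g == edges c h.
    by rewrite eqEcard ss !card_edges //; lia.
  have [gn' hn'] : 0 < g < n /\ 0 < h < n by lia.
  by have [] := edges_inj gn' hn' eE.
- by rewrite (@sub_edges_vtx a g c h ) //; lia.
Qed.

(** * Consecutive puncture vertices *)

Lemma zip_consec z (s : seq nat) m (p : nat * nat) : path ltn z (rcons s m) ->
  p \in zip (z :: s) (rcons s m) ->
  [/\ p.1 \in z :: s, p.2 \in rcons s m, p.1 < p.2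
    & forall d : nat, d \in z :: s -> d <= p.1 \/ p.2 <= d].
Proof.
elim: s z => [|y s IHs] z /=.
  rewrite andbT inE => zm /eqP -> /=; split=> //; rewrite ?inE ?eqxx //.
  by move=> d; rewrite inE => /eqP ->; left.
move=> /andP[zy pth]; rewrite inE => /orP[/eqP -> /=|pz].
  split=> //; rewrite ?inE ?eqxx //.
  move=> d; rewrite inE => /orP[/eqP ->|dy]; [by left | right].
  have := pth; rewrite rcons_path => /andP[pth' _].
  move: dy; rewrite inE => /orP[/eqP -> //|].
  by move/(allP (order_path_min ltn_trans pth')) => /= /ltnW.
have [p1 p2 lt12 sep] := IHs y pth pz.
split=> //; rewrite 1?inE ?p1 ?p2 ?orbT //.
move=> d; rewrite inE => /orP[/eqP ->|/sep //]; left.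
apply: ltnW; move: p1; rewrite inE => /orP[/eqP -> //|].
have := pth; rewrite rcons_path => /andP[pth' _].
by move/(allP (order_path_min ltn_trans pth')) => /=; apply: ltn_trans.
Qed.

(** The leaf counts telescope, so each subtree starts at the first component of its pair. *)
Lemma tops_zip (f : nat * nat -> bt) z s m : path ltn z (rcons s m) ->
  (forall p, p \in zip (z :: s) (rcons s m) -> bt_leaves (f p) = p.2 - p.1) ->
  z + rtree_leaves [seq f p | p <- zip (z :: s) (rcons s m)] = m /\
  tops [seq f p | p <- zip (z :: s) (rcons s m)] z =
  [seq (f p, p.1) | p <- zip (z :: s) (rcons s m)].
Proof.
elim: s z => [|y s IHs] z /=.
  rewrite andbT => zm fE; split=> //.
  by rewrite rtree_leaves_cons fE ?inE ?eqxx //= addn0; lia.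
move=> /andP[zy pth] fE; rewrite rtree_leaves_cons.
have -> : bt_leaves (f (z, y)) = y - z by rewrite fE ?inE ?eqxx.
rewrite addnA subnKC 1?ltnW //.
have [] := IHs y pth; first by move=> p ps; apply: fE; rewrite inE ps orbT.
by move=> -> /= ->.
Qed.

Lemma punct_verts_path D z s : punct_verts D = z :: s -> path ltn z (rcons s (z + n)).
Proof.
move=> E; have := punct_verts_sorted D; rewrite E /= => pth.
rewrite rcons_path pth /=; have : last z s \in punct_verts D by rewrite E mem_last.
by case/mem_punct_verts; lia.
Qed.

Lemma sigmaE D z s : punct_verts D = z :: s ->
  sigma D = [seq cap_tree D n p.1 (p.2 - p.1) | p <- zip (z :: s) (rcons s (z + n))].
Proof. by rewrite /sigma => ->. Qed.

(** * Reconstruction of a triangulation from its tree *)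

Section Reconstruction.

Variables (D : {set tarc n}) (z0 : nat) (s0 : seq nat).
Hypotheses (Dt : triangulation D) (DE : punct_verts D = z0 :: s0).

Lemma punct_bounds (d : nat) : d \in z0 :: s0 -> z0 <= d < n.
Proof.
move=> ds; have : d \in punct_verts D by rewrite DE.
case/mem_punct_verts => dn _; rewrite dn andbT.
have := punct_verts_sorted D; rewrite DE /= => /(order_path_min ltn_trans)/allP h.
by move: ds; rewrite inE => /orP[/eqP -> //|/h /= /ltnW].
Qed.

Lemma punct_mem c e : inr (c, e) \in D -> (c : nat) \in z0 :: s0.
Proof.
move=> cD; rewrite -DE; apply/mem_punct_verts; split; first exact: ltn_ord.
by exists e; rewrite vtx_val.
Qed.

Lemma consec_bounds (p : nat * nat) : p \in zip (z0 :: s0) (rcons s0 (z0 + n)) ->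
  [/\ p.1 \in z0 :: s0, p.1 < p.2, p.2 <= z0 + n,
      exists2 d : nat, d \in z0 :: s0 & vtx p.2 = vtx d
    & forall d : nat, d \in z0 :: s0 -> d <= p.1 \/ p.2 <= d].
Proof.
move=> /(zip_consec (punct_verts_path DE)) [p1 p2 lt12 sep].
have [le2 ex2] : p.2 <= z0 + n /\ exists2 d : nat, d \in z0 :: s0 & vtx p.2 = vtx d.
  move: p2; rewrite mem_rcons inE => /orP[/eqP ->|ps].
    by split=> //; exists z0; rewrite ?vtxDn // inE eqxx.
  have ps' : p.2 \in z0 :: s0 by rewrite inE ps orbT.
  by split; [have := punct_bounds ps'; lia | exists p.2].
by split.
Qed.

(** The puncture arcs at [p.1] and [p.2] keep every arc of [D] from passing over these vertices, and
    no puncture arc ends strictly between them. The side joining them is therefore in [D] by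
    maximality, unless it is a border edge or the loop at a lone puncture vertex. *)
Lemma consec_region (p : nat * nat) : p \in zip (z0 :: s0) (rcons s0 (z0 + n)) ->
  region D p.1 (p.2 - p.1).
Proof.
move=> /consec_bounds[p1 lt12 le2 [d2 d2s d2E] sep].
have [Dv Dc Dm] := Dt; have p1b := punct_bounds p1.
have p1v : vtx p.1 = p.1 :> nat by rewrite /= modn_small //; case/andP: p1b.
have punD d : d \in z0 :: s0 -> exists e, inr (vtx d, e) \in D.
  by rewrite -DE => /mem_punct_verts[].
have [gn|gn] := eqVneq (p.2 - p.1) n.
  right; split=> //; split; first exact: punD.
  move=> c e /punct_mem cs; apply: ord_inj; rewrite p1v.
  by have := sep _ cs; have := punct_bounds cs; lia.
have gn' : 0 < p.2 - p.1 < n by lia.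
left; split=> //; rewrite side_okE; apply/orP.
case: eqVneq => [|g1]; [by left | right].
have gn2 : p.2 - p.1 < n by lia.
have pE : p.1 + (p.2 - p.1) = p.2 by lia.
apply: Dm; first by apply: valid_arc_gap; lia.
case=> [[a b]|[c e]] wD; last first.
  rewrite compat_arc_punct // inE gapE p1v; have cs := punct_mem wD.
  apply/implyP; have := sep _ cs; have := punct_bounds cs => cb sepc cg.
  apply/eqP/ord_inj; rewrite p1v.
  by move: cg; case: ifP; lia.
have [wE hn] := valid_arcP (Dv _ wD); rewrite wE in wD *.
have nint d : d \in z0 :: s0 -> vtx d \in edges a (gap a b) -> vtx d = vtx a.
  move=> /punD[e dD]; have := Dc _ _ wD dD; rewrite compat_arc_punct; last lia.
  by move=> /implyP h /h/eqP.
rewrite compat_arc //; last lia.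
apply: laminar_edges => //; first exact: nint.
by rewrite pE d2E; apply: nint.
Qed.

Lemma consec_leaves (p : nat * nat) : p \in zip (z0 :: s0) (rcons s0 (z0 + n)) ->
  bt_leaves (cap_tree D n p.1 (p.2 - p.1)) = p.2 - p.1.
Proof.
move=> /consec_bounds[/punct_bounds p1b lt12 le2 _ _].
by apply: leaves_cap_tree; lia.
Qed.

Lemma leaves_sigma_cons : rtree_leaves (sigma D) = n.
Proof.
rewrite (sigmaE DE); have [] := tops_zip (punct_verts_path DE) consec_leaves.
by lia.
Qed.

Lemma sigma_tri_sub : exists e, tri_of (sigma D) z0 e \subset D.
Proof.
have [Dv Dc Dm] := Dt.
(* With several puncture vertices all tags agree with this one; a lone vertex carries both tags, so
   either choice works. *)
have [e0 e0D] : exists e, inr (vtx z0, e) \in D.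
  have : z0 \in punct_verts D by rewrite DE inE eqxx.
  by case/mem_punct_verts.
exists e0; apply/subsetP => w /tri_ofP wP.
have [_] := tops_zip (punct_verts_path DE) consec_leaves.
rewrite -(sigmaE DE) => topsE.
case: wP => [p /rregsP[q]|q b]; rewrite topsE => /mapP[r rs ->] /=.
  have [/punct_bounds r1 _ r2 _ _] := consec_bounds rs.
  by apply: regs_cap_tree; [|apply: consec_region|lia].
have [r1 _ _ _ _] := consec_bounds rs.
have [e eD] : exists e, inr (vtx r.1, e) \in D.
  by move: r1; rewrite -DE => /mem_punct_verts[].
case/orP => [/eqP s1|/eqP ->]; last first.
  have := Dc _ _ e0D eD => /= /orP[/eqP <- //|/eqP -> //].
have s0E : s0 = [::].
  by move: s1; rewrite (sigmaE DE) size_map size_zip size_rcons /= minnn; case: (s0).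
have r1E : r.1 = z0 by move: r1; rewrite s0E inE => /eqP.
(* Compatibility with border arcs ignores the tag, and all puncture arcs of [D] end at [z0], so
   maximality puts both tags into [D]. *)
rewrite r1E; apply: Dm => // -[[a b']|[c e']] wD.
  exact: (Dc _ _ e0D wD).
by have := punct_mem wD; rewrite s0E inE => /eqP <-; rewrite vtx_val /= eqxx.
Qed.

End Reconstruction.

(** * Injectivity on classes *)

Lemma triangulation_sub D D' : triangulation D -> triangulation D' ->
  D \subset D' -> D = D'.
Proof.
move=> [_ _ Dm] [Dv Dc _] sub; apply/eqP; rewrite eqEsubset sub.
apply/subsetP => w wD; apply: Dm; first exact: Dv.
by move=> u /(subsetP sub); apply: Dc.
Qed.

Lemma punct_verts_cons D : triangulation D -> exists z s, punct_verts D = z :: s.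
Proof.
move=> /punct_exists[c [e cD]].
have : (c : nat) \in punct_verts D.
  apply/mem_punct_verts; split; first exact: ltn_ord.
  by exists e; rewrite vtx_val.
by case: (punct_verts D) => // z s _; exists z, s.
Qed.

Lemma leaves_sigma D : triangulation D -> rtree_leaves (sigma D) = n.
Proof. by move=> /punct_verts_cons[z [s E]]; apply: leaves_sigma_cons E. Qed.

Lemma tri_of_sigma D : triangulation D -> exists z e, D = tri_of (sigma D) z e.
Proof.
move=> Dt; have [z [s E]] := punct_verts_cons Dt.
have [e sub] := sigma_tri_sub Dt E; exists z, e; apply/esym.
apply: (triangulation_sub _ Dt sub).
exact/tri_of_triangulation/leaves_sigma.
Qed.

Lemma sigma_inj D D' : triangulation D -> triangulation D' ->
  rot_equiv (sigma D) (sigma D') -> tri_equiv D D'.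
Proof.
move=> Dt Dt' [k kE]; have [z [e DE]] := tri_of_sigma Dt.
have [z' [e' DE']] := tri_of_sigma Dt'.
by rewrite DE DE' -kE; apply: tri_equiv_rot; apply: leaves_sigma.
Qed.

(** * Invariance under rotation and tag inversion *)

Lemma rot_equiv_refl s : rot_equiv s s.
Proof. by exists 0; apply: rot0. Qed.

Lemma rot_equiv_sym s t : rot_equiv s t -> rot_equiv t s.
Proof. by case=> k <-; exists (size (rot k s) - k); apply: rotK. Qed.

Lemma rot_equiv_trans s t u : rot_equiv s t -> rot_equiv t u -> rot_equiv s u.
Proof.
case=> k <- [l <-]; rewrite [rot l _]rot_minn size_rot [rot k s]rot_minn.
by rewrite rot_add_mod ?geq_minr //; eexists.
Qed.

Lemma inv_arcK : involutive (@inv_arc n).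
Proof. by case=> // -[c e]; rewrite /= negbK. Qed.

Lemma shiftv_inj : injective (@shiftv n).
Proof.
move=> a b; rewrite -{1}(vtx_val a) -{1}(vtx_val b) !shiftv_vtx => /(congr1 (gap (vtx 1))).
rewrite -!(addn1 (nat_of_ord _)) -!(addnC 1) -{1}(modn_small (ltn_ord a)).
rewrite !gap_vtx //; last by rewrite modn_small.
by rewrite modn_small // => /ord_inj.
Qed.

Lemma rot_arc_inj : injective (@rot_arc n).
Proof.
move=> [[a b]|[c e]] [[a' b']|[c' e']] //= [].
  by move=> ea eb; congr (inl (_, _)); apply: shiftv_inj; apply: val_inj.
by move=> ec ->; congr (inr (_, _)); apply: shiftv_inj; apply: val_inj.
Qed.

Lemma mem_inv_arc D w : (w \in @inv_arc n @: D) = (inv_arc w \in D).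
Proof. by rewrite -{1}(inv_arcK w) mem_imset //; apply: can_inj inv_arcK. Qed.

Lemma arc_rot D z g : (arc (z + 1) g \in @rot_arc n @: D) = (arc z g \in D).
Proof.
rewrite -[RHS](mem_imset _ _ rot_arc_inj) /arc addnAC !addn1 /=.
by rewrite !shiftv_vtx.
Qed.

(** Used with [k = 0] for tag inversion, with [k = 1] for the rotation, and with [k = n] to reduce
    positions modulo [n]. *)
Lemma cap_tree_shift D D' k m z g :
  (forall z g, (arc (z + k) g \in D') = (arc z g \in D)) ->
  cap_tree D' m (z + k) g = cap_tree D m z g.
Proof.
move=> DD'; elim: m z g => //= m IHm z g; case: leqP => // g1.
have -> : [seq l <- iota 1 g.-1 | side_ok D' (z + k) l && side_ok D' (z + k + l) (g - l)] =
    [seq l <- iota 1 g.-1 | side_ok D z l && side_ok D (z + l) (g - l)].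
  by apply: eq_filter => l; rewrite !side_okE addnAC !DD'.
by rewrite IHm addnAC IHm.
Qed.

Lemma sigma_inv D : sigma (@inv_arc n @: D) = sigma D.
Proof.
have pE : punct_verts (@inv_arc n @: D) = punct_verts D.
  congr map; apply: eq_filter => c; apply/existsP/existsP => -[e].
    by rewrite mem_inv_arc; exists (~~ e).
  by exists (~~ e); rewrite mem_inv_arc /= negbK.
rewrite /sigma pE; apply: eq_map => p; rewrite -[p.1]addn0.
by rewrite (@cap_tree_shift D) ?addn0 // => z g; rewrite addn0 mem_inv_arc.
Qed.

Lemma punct_verts_rot D z : z < n ->
  ((z.+1 %% n \in punct_verts (@rot_arc n @: D)) = (z \in punct_verts D)).
Proof.
move=> zn.
have E e : (inr (vtx (z.+1 %% n), e) \in @rot_arc n @: D) = (inr (vtx z, e) \in D).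
  have -> : vtx (z.+1 %% n) = vtx z.+1 by apply: val_inj; rewrite /= modn_mod.
  by rewrite -[RHS](mem_imset _ _ rot_arc_inj) /= shiftv_vtx.
apply/idP/idP => /mem_punct_verts[_ [e eD]]; apply/mem_punct_verts.
  by split=> //; exists e; rewrite -E.
by split; [rewrite ltn_mod; lia | exists e; rewrite E].
Qed.

Lemma zip_mapS (s t : seq nat) :
  zip (map succn s) (map succn t) = [seq (p.1.+1, p.2.+1) | p <- zip s t].
Proof. by elim: s t => [|x s IHs] [|y t] //=; rewrite IHs. Qed.

(** Rotation adds one to every puncture vertex except [n.-1], which becomes [0]. If [n.-1] is not a
    puncture vertex, the tree is unchanged; otherwise the last subtree at the root becomes the
    first. *)
Lemma sigma_rot D : rot_equiv (sigma D) (sigma (@rot_arc n @: D)).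
Proof.
set D' := @rot_arc n @: D.
have capS z g : cap_tree D' n z.+1 g = cap_tree D n z g.
  by rewrite -addn1; apply: cap_tree_shift => *; apply: arc_rot.
have mapS (s t : seq nat) :
    [seq cap_tree D' n p.1 (p.2 - p.1) | p <- zip (map succn s) (map succn t)] =
    [seq cap_tree D n p.1 (p.2 - p.1) | p <- zip s t].
  by rewrite zip_mapS -map_comp; apply: eq_map => p /=; rewrite subSS capS.
have inD z : z \in punct_verts D -> z < n by case/mem_punct_verts.
have inD' z : z \in punct_verts D' -> z < n by case/mem_punct_verts.
have n0 : n.-1.+1 = n by lia.
have S_mono : {mono succn : x y / ltn x y} by move=> x y /=; lia.
have mem0 : (0 \in punct_verts D') = (n.-1 \in punct_verts D).
  by have := @punct_verts_rot D n.-1; rewrite n0 modnn; apply; lia.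
have memS z : z.+1 < n -> (z.+1 \in punct_verts D') = (z \in punct_verts D).
  by move=> zn; have := @punct_verts_rot D z; rewrite modn_small //; apply; lia.
have [nD|nD] := boolP (n.-1 \in punct_verts D); last first.
  have pE : punct_verts D' = map succn (punct_verts D).
    apply: (irr_sorted_eq ltn_trans ltnn); first exact: punct_verts_sorted.
      by rewrite (mono_sorted S_mono) punct_verts_sorted.
    case=> [|z]; first by rewrite mem0 (negPf nD); apply/esym/mapP => -[].
    rewrite mem_map; last exact: succn_inj.
    apply/idP/idP => zD; first by rewrite -memS // inD'.
    rewrite memS //; have := inD _ zD.
    by have : z != n.-1 by [apply: contraNneq nD => <-]; lia.
  rewrite /sigma pE; case: (punct_verts D) => [|c s]; first exact: rot_equiv_refl.
  rewrite /= addSn -map_rcons.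
  have := mapS (c :: s) (rcons s (c + n)); rewrite /= => ->.
  exact: rot_equiv_refl.
have [s pE] : exists s, punct_verts D = rcons s n.-1.
  have := punct_verts_sorted D.
  case: (lastP (punct_verts D)) nD inD => [|s x] // nD inD sD.
  exists s; congr rcons; apply/eqP; rewrite eqn_leq; apply/andP; split.
    by have : x < n by [apply: inD; rewrite mem_rcons inE eqxx]; lia.
  move: nD; rewrite mem_rcons inE => /orP[/eqP -> //|ns].
  move: sD; rewrite (sorted_pairwise ltn_trans) pairwise_rcons => /andP[/allP h _].
  by have /= := h _ ns; lia.
have pE' : punct_verts D' = 0 :: map succn s.
  have := punct_verts_sorted D; rewrite pE (sorted_pairwise ltn_trans) pairwise_rcons.
  rewrite -(sorted_pairwise ltn_trans) => /andP[/allP sn ss].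
  apply: (irr_sorted_eq ltn_trans ltnn); first exact: punct_verts_sorted.
    rewrite /= (path_sortedE ltn_trans) (mono_sorted S_mono) ss andbT.
    by apply/allP => _ /mapP[z _ ->].
  case=> [|z]; first by rewrite mem0 nD inE eqxx.
  rewrite inE /= mem_map; last exact: succn_inj.
  apply/idP/idP => zD.
    have zn := inD' _ zD; move: zD; rewrite memS // pE mem_rcons inE.
    by case/orP => // /eqP zE; lia.
  have /= zn := sn _ zD; rewrite memS ?pE ?mem_rcons ?inE ?zD ?orbT //; lia.
(* Position [0] of [D'] is also position [n], the successor of [n.-1]. *)
have cap0 g : cap_tree D' n 0 g = cap_tree D n n.-1 g.
  have <- : cap_tree D' n (0 + n) g = cap_tree D' n 0 g.
    by apply: cap_tree_shift => z h; rewrite arcDn.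
  by rewrite add0n -capS n0.
rewrite /sigma pE pE'; case: s pE {pE'} => [|c s] _.
  exists 0; rewrite rot0 /= cap0; congr [:: cap_tree _ _ _ _]; lia.
(* With the closing position [n] written as a successor, all pairs but the first are successors of
   pairs of [D]. The first corresponds to the last pair of [D], so rotating by the number of the
   others, [size u], matches the trees. *)
rewrite /= add0n -[X in _ :: map _ (zip _ (rcons _ X))]n0.
rewrite -map_rcons.
have /= -> := mapS (c :: s) (rcons s n.-1).
rewrite -rcons_cons zip_rcons /= ?size_rcons // map_rcons -cats1.
set u := map _ _; exists (size u); rewrite rot_size_cat /= subn0 cap0.
by congr (cap_tree _ _ _ _ :: _); lia.
Qed.

Lemma sigma_tri_equiv D D' : tri_equiv D D' -> rot_equiv (sigma D) (sigma D').
Proof.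
elim=> [u v [->|->]|u|u v _|u v w _ uv _].
- exact: sigma_rot.
- by rewrite sigma_inv; apply: rot_equiv_refl.
- exact: rot_equiv_refl.
- exact: rot_equiv_sym.
- exact: rot_equiv_trans uv.
Qed.

End Punctured.

Theorem theorem7p1 (n : nat) (hn : 5 <= n) :
  (* sigma lands in B_n *)
  (forall D : {set tarc n}, triangulation D -> rtree_leaves (sigma D) = n) /\
  (* sigma is well defined on T_n / ~ *)
  (forall D D' : {set tarc n}, triangulation D -> triangulation D' ->
     tri_equiv D D' -> rot_equiv (sigma D) (sigma D')) /\
  (* injective on T_n / ~ *)
  (forall D D' : {set tarc n}, triangulation D -> triangulation D' ->
     rot_equiv (sigma D) (sigma D') -> tri_equiv D D') /\
  (* surjective onto B_n *)
  (forall s : rtree, rtree_leaves s = n ->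
     exists D : {set tarc n}, triangulation D /\ rot_equiv (sigma D) s).
Proof.
have n_gt1 : 1 < n by apply: leq_trans hn.
split; first exact: leaves_sigma.
split; first by move=> D D' _ _; apply: sigma_tri_equiv.
split; first exact: sigma_inj.
move=> s sn; exists (tri_of n_gt1 s 0 true); split.
  exact: tri_of_triangulation.
by rewrite sigma_tri_of //; apply: rot_equiv_refl.
Qed.
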